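(* There exists a Sidon set $S\subset\mathbb{N}^*$ such that $$\int_0^1 f_S(t)^2\,dt=+\infty,$$ where $f_S(t)=\sum_{s\in S}t^s$.
   Context: A Sidon set is a set $S$ of positive integers such that all the sums $s+s'$ with $s,s'\in S$, $s\le s'$, are distinct. *)

(* Defs.v *)
From mathcomp Require Import all_boot all_order all_algebra.
From mathcomp Require Import all_classical all_reals all_analysis.

Set Implicit Arguments.
Unset Strict Implicit.
Unset Printing Implicit Defensive.

Import Order.TTheory GRing.Theory Num.Theory.
Import numFieldNormedType.Exports.

Local Open Scope classical_set_scope.
Local Open Scope ring_scope.

Definition sidon (S : set nat) : Prop :=
  (forall s, S s -> (0 < s)%N) /\
  (forall a b c d, S a -> S b -> S c -> S d ->
     (a <= b)%N -> (c <= d)%N -> (a + b = c + d)%N -> a = c /\ b = d).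

(* [esum] is a supremum of finite partial sums, hence the sum of the series only
   when the terms are nonnegative: [gen_fun] is meant for 0 <= t. At t = 1 it is
   +oo when S is infinite. *)
Definition gen_fun (R : realType) (S : set nat) (t : R) : \bar R :=
  \esum_(s in S) (t ^+ s)%:E.

(* Main.v *)
(** For an odd prime p, the Erdos-Turan set
    [{3p^2 + 2pk + (k^2 mod p) | k < p}] is a Sidon set of p elements lying in
    [[3p^2, 5p^2)], any two of which differ by more than p.  Take primes growing so
    fast that each exceeds all the elements built from the previous ones, and let S
    be the union of these sets.  In an equality a + b = c + d of S with a <= b and
    c <= d, size forces b and d into the same block; if a and c are both in lower
    blocks, then |b - d| < p, hence b = d.  On [[0, 1]] the block of p contributes
    at least p t^(5p^2) to f_S, so f_S^2 dominates the sum over the chosen primes of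
    p^2 t^(10p^2), each term of which has integral at least 1/11. *)

Require Import Defs.
From mathcomp Require Import all_boot all_order all_algebra.
From mathcomp Require Import all_classical all_reals all_analysis.
From mathcomp Require Import measurable_realfun zify.

Set Implicit Arguments.
Unset Strict Implicit.
Unset Printing Implicit Defensive.

Import Order.TTheory GRing.Theory Num.Theory.
Import numFieldNormedType.Exports.

Local Open Scope classical_set_scope.
Local Open Scope ring_scope.

(* The shift [3 * p ^ 2] puts the whole set in an interval [[L, 2L - p)], so a sum of
   two elements exceeds the sum of an element and a number below p. *)
Definition erdos_turan (p k : nat) : nat :=
  (3 * p ^ 2 + 2 * p * k + k ^ 2 %% p)%N.

Lemma erdos_turan_lower p k : (3 * p ^ 2 <= erdos_turan p k)%N.
Proof. by rewrite /erdos_turan -addnA leq_addr. Qed.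

Lemma erdos_turan_upper p k : (k < p)%N -> (erdos_turan p k < 5 * p ^ 2)%N.
Proof.
move=> kp; have p0 : (0 < p)%N by lia.
have := ltn_pmod (k ^ 2) p0; rewrite /erdos_turan; nia.
Qed.

Lemma erdos_turan_gap p k l : (l < k < p)%N ->
  (erdos_turan p l + p < erdos_turan p k)%N.
Proof.
case/andP=> lk kp; have p0 : (0 < p)%N by lia.
have := ltn_pmod (l ^ 2) p0; rewrite /erdos_turan; nia.
Qed.

Lemma eq_modn_mul2l p m a b : coprime p m -> (a < p)%N -> (b < p)%N ->
  m * a = m * b %[mod p] -> a = b.
Proof.
move=> pm; wlog ab : a b / (a <= b)%N => [wlg ap bp e|].
  by case/orP: (leq_total a b) => h; [|symmetry]; exact: wlg.
move=> ap bp /esym/eqP; rewrite eqn_mod_dvd ?leq_mul2l ?ab ?orbT//.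
rewrite -mulnBr Gauss_dvdr// => pab.
by have [/eqP|h] := posnP (b - a); [lia|have := dvdn_leq h pab; lia].
Qed.

Lemma euclid_uniq d q1 q2 r1 r2 : (r1 < d)%N -> (r2 < d)%N ->
  (d * q1 + r1 = d * q2 + r2)%N -> q1 = q2 /\ r1 = r2.
Proof.
move=> r1d r2d; rewrite ![(d * _)%N]mulnC => e.
have := congr1 (edivn^~ d) e; rewrite !edivn_eq//.
by case.
Qed.

(* The quotient by [2 * p] preserves the sum of the indices, and then the
   residues modulo p preserve the sum of their squares. *)
Lemma erdos_turan_sidon p k1 k2 l1 l2 : prime p -> (2 < p)%N ->
  (k1 < p)%N -> (k2 < p)%N -> (l1 < p)%N -> (l2 < p)%N ->
  (erdos_turan p k1 + erdos_turan p k2 =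
   erdos_turan p l1 + erdos_turan p l2)%N ->
  k1 = l1 /\ k2 = l2 \/ k1 = l2 /\ k2 = l1.
Proof.
move=> pp p2 + + + +.
wlog le : k1 k2 l1 l2 / (l1 <= k1)%N => [wlg k1p k2p l1p l2p e|].
  case/orP: (leq_total l1 k1) => h; first exact: wlg.
  by case: (wlg _ _ _ _ h l1p l2p k1p k2p (esym e)) => -[-> ->]; [left|right].
move=> k1p k2p l1p l2p; rewrite /erdos_turan => e.
have p0 : (0 < p)%N by case: (p) p2.
have [sumE resE] : (k1 + k2 = l1 + l2)%N /\
    (k1 ^ 2 %% p + k2 ^ 2 %% p = l1 ^ 2 %% p + l2 ^ 2 %% p)%N.
  (* Two residues below [p] add up to less than [2 * p]; this is why the indices carry the factor
     [2 * p]. *)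
  apply: (@euclid_uniq (2 * p)).
  - by rewrite mul2n -addnn -addSn leq_add// ?ltn_pmod// ltnW// ltn_pmod.
  - by rewrite mul2n -addnn -addSn leq_add// ?ltn_pmod// ltnW// ltn_pmod.
  (* The shift [3 * p ^ 2] occurs twice on each side. *)
  - apply/eqP; rewrite -(eqn_add2l (6 * p ^ 2)); apply/eqP; move: e.
    move: (k1 ^ 2 %% p)%N (k2 ^ 2 %% p)%N (l1 ^ 2 %% p)%N (l2 ^ 2 %% p)%N => *.
    lia.
have {e resE} eq_sq : k1 ^ 2 + k2 ^ 2 = l1 ^ 2 + l2 ^ 2 %[mod p].
  by rewrite -modnDm -[RHS]modnDm resE.
move: eq_sq; have [d k1E] : exists d, k1 = (l1 + d)%N.
  by exists (k1 - l1)%N; rewrite subnKC.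
have l2E : l2 = (k2 + d)%N by lia.
have [d0|d0] := posnP d; first by left; lia.
rewrite k1E l2E.
(* Cancelling the common terms leaves [2 * d * l1 = 2 * d * k2] modulo [p], and [2 * d] is prime to
   [p] because [p] is odd and [0 < d < p]. *)
have -> : ((l1 + d) ^ 2 + k2 ^ 2
  = (l1 ^ 2 + d ^ 2 + k2 ^ 2) + (2 * d) * l1)%N by lia.
have -> : (l1 ^ 2 + (k2 + d) ^ 2
  = (l1 ^ 2 + d ^ 2 + k2 ^ 2) + (2 * d) * k2)%N by lia.
move/eqP; rewrite eqn_modDl => /eqP /eq_modn_mul2l lk; right.
suff : l1 = k2 by lia.
apply: lk => //; rewrite coprimeMr !prime_coprime// !gtnNdvd//; lia.
Qed.

(** The bound 2 makes the first prime odd; the bound [5 * p ^ 2] puts each later prime above the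
    whole block of its predecessor [p]. *)
Fixpoint block_prime (n : nat) : nat :=
  s2val (prime_above (if n is m.+1 then 5 * block_prime m ^ 2 else 2)).

Lemma block_prime_prime n : prime (block_prime n).
Proof. by case: n => [|n] /=; case: prime_above. Qed.

Lemma block_primeS n : (5 * block_prime n ^ 2 < block_prime n.+1)%N.
Proof. by rewrite /=; case: prime_above. Qed.

Lemma block_prime_lt n m : (n < m)%N ->
  (5 * block_prime n ^ 2 < block_prime m)%N.
Proof.
elim: m => // m IH; rewrite ltnS leq_eqVlt => /predU1P[->|/IH]; first exact: block_primeS.
by have := block_primeS m; nia.
Qed.

Lemma block_prime_gt2 n : (2 < block_prime n)%N.
Proof.
elim: n => [|n IH]; first by rewrite /=; case: prime_above.
by have := block_primeS n; nia.
Qed.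

Lemma erdos_turan_block_lt n m k : (n < m)%N -> (k < block_prime n)%N ->
  (erdos_turan (block_prime n) k < block_prime m)%N.
Proof. by move=> nm /erdos_turan_upper; have := block_prime_lt nm; lia. Qed.

Lemma erdos_turan_block_inj n m k l : (k < block_prime n)%N -> (l < block_prime m)%N ->
  erdos_turan (block_prime n) k = erdos_turan (block_prime m) l -> n = m /\ k = l.
Proof.
have sep i j x y : (i < j)%N -> (x < block_prime i)%N ->
    (erdos_turan (block_prime i) x < erdos_turan (block_prime j) y)%N.
  move=> ij /(erdos_turan_block_lt ij); have := block_prime_gt2 j.
  by have := erdos_turan_lower (block_prime j) y; nia.
move=> kn lm e; case: (ltngtP n m) => [nm|mn|nm].
- by have := sep n m k l nm kn; rewrite e ltnn.
- by have := sep m n l k mn lm; rewrite e ltnn.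
- subst m; split=> //; case: (ltngtP k l) => // h.
  + by have := @erdos_turan_gap (block_prime n) l k; rewrite h lm e => /(_ isT); lia.
  + by have := @erdos_turan_gap (block_prime n) k l; rewrite h kn e => /(_ isT); lia.
Qed.

Definition block_sidon : set nat :=
  [set s | exists n k, (k < block_prime n)%N /\ s = erdos_turan (block_prime n) k].

Lemma sidon_block_sidon : sidon block_sidon.
Proof.
split=> [s [n [k [_ ->]]]|].
  have := erdos_turan_lower (block_prime n) k; have := block_prime_gt2 n; nia.
(* If [b] were in a lower block than [d], then with [p] the prime of [d],
   [a + b <= 2 * b < 2 * p < 3 * p ^ 2 <= d]. *)
have top a b c d n m k l : (a <= b)%N -> (a + b = c + d)%N ->
    b = erdos_turan (block_prime n) k -> (k < block_prime n)%N ->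
    d = erdos_turan (block_prime m) l -> (n < m)%N -> False.
  move=> ab e bE kn dE nm; have := erdos_turan_block_lt nm kn.
  have := erdos_turan_lower (block_prime m) l.
  by have := block_prime_gt2 m; nia.
move=> a b c d [n1 [k1 [k1p aE]]] [n2 [k2 [k2p bE]]]
  [m1 [l1 [l1p cE]]] [m2 [l2 [l2p dE]]] ab cd e.
have nm : n2 = m2.
  case: (ltngtP n2 m2) => // h.
    by case: (top _ _ _ _ _ _ _ _ ab e bE k2p dE h).
  by case: (top _ _ _ _ _ _ _ _ cd (esym e) dE l2p bE h).
subst m2.
have le n m k l : (l < block_prime m)%N ->
    (erdos_turan (block_prime n) k <= erdos_turan (block_prime m) l)%N -> (n <= m)%N.
  move=> lm h; rewrite leqNgt; apply/negP => /erdos_turan_block_lt/(_ lm).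
  by have := erdos_turan_lower (block_prime n) k; have := block_prime_gt2 n; nia.
have n1n : (n1 <= n2)%N by apply: (le _ _ k1 k2) => //; rewrite -aE -bE.
have m1n : (m1 <= n2)%N by apply: (le _ _ l1 l2) => //; rewrite -cE -dE.
have P0 := block_prime_gt2 n2.
have := erdos_turan_lower (block_prime n2) k1.
have := erdos_turan_lower (block_prime n2) l1.
have := erdos_turan_lower (block_prime n2) k2.
have := erdos_turan_lower (block_prime n2) l2.
have := erdos_turan_upper k2p.
have := erdos_turan_upper l2p.
rewrite -bE -dE => ub ud lb ld.
move: n1n m1n; rewrite (leq_eqVlt n1) (leq_eqVlt m1) => /predU1P[n1E|n1l] /predU1P[m1E|m1l] lc la.
- subst n1 m1.
  case: (@erdos_turan_sidon (block_prime n2) k1 k2 l1 l2) => //.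
  + exact: block_prime_prime.
  + by rewrite -aE -bE -cE -dE.
  + by move=> [k1l1 k2l2]; split; [rewrite aE k1l1|rewrite bE k2l2].
  (* Here [a = d] and [b = c], so [a <= b] and [c <= d] make all four equal. *)
  + by move=> [k1l2 k2l1]; subst k1 k2; lia.
(* With [p] the top prime, [a + b >= 6 * p ^ 2], whereas [c + d < p + 5 * p ^ 2]. The next case is
   symmetric. *)
- have := erdos_turan_block_lt m1l l1p; subst n1; rewrite -aE in la; nia.
- have := erdos_turan_block_lt n1l k1p; subst m1; rewrite -cE in lc; nia.
- have := erdos_turan_block_lt m1l l1p; have := erdos_turan_block_lt n1l k1p.
  rewrite -aE -cE => aP cP.
  (* Both [a] and [c] are below the top prime, so [b] and [d] are too close to be distinct elements
     of its block. *)
  case: (ltngtP k2 l2) => h.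
  + by have := @erdos_turan_gap (block_prime n2) l2 k2; rewrite h l2p -bE -dE => /(_ isT); lia.
  + by have := @erdos_turan_gap (block_prime n2) k2 l2; rewrite h k2p -bE -dE => /(_ isT); lia.
  + by subst l2; lia.
Qed.

(* Unlike [ge0_le_integral], no measurability is needed, the integral being a
   supremum over simple functions. *)
Lemma ge0_le_integral_nomeas d (T : measurableType d) (R : realType)
    (mu : {measure set T -> \bar R}) (D : set T) (f g : T -> \bar R) :
  (forall x, D x -> (0 <= f x)%E) -> (forall x, D x -> (f x <= g x)%E) ->
  (\int[mu]_(x in D) f x <= \int[mu]_(x in D) g x)%E.
Proof.
move=> f0 fg; rewrite !ge0_integralE//; last first.
  by move=> x Dx; exact: le_trans (f0 x Dx) (fg x Dx).
apply: le_ereal_sup => _ [h hf <-]; exists h => // x.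
by apply: le_trans (hf x) _; exact: lee_restrict.
Qed.

Lemma integral_exprn (R : realType) n :
  (\int[@lebesgue_measure R]_(t in `[0%R, 1%R]) (t ^+ n)%:E = (n.+1%:R^-1)%:E)%E.
Proof.
rewrite (@continuous_FTC2 _ _ (fun x => x ^+ n.+1 / n.+1%:R))//=.
- by rewrite expr1n expr0n mul0r mul1r sube0.
- by apply: continuous_in_subspaceT => x _; exact: exprn_continuous.
- split.
  + by move=> x _; apply: derivableM => //; exact: exprn_derivable.
  + apply: cvg_at_right_filter; apply: cvgM; last exact: cvg_cst.
    exact: exprn_continuous.
  + apply: cvg_at_left_filter; apply: cvgM; last exact: cvg_cst.
    exact: exprn_continuous.
- move=> x _; rewrite derive1Mr//; last exact: exprn_derivable.
  by rewrite derive1E exp_derive// scaler1 mulrAC divff// mul1r.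
Qed.

(** The cross terms are nonnegative. The sum of squares can then be integrated term by term. *)
Lemma sum_sqr_le (R : realDomainType) n (a : nat -> R) : (forall i, 0 <= a i) ->
  \sum_(i < n) a i ^+ 2 <= (\sum_(i < n) a i) ^+ 2.
Proof.
move=> a0; elim: n => [|n IH]; first by rewrite !big_ord0 expr0n.
rewrite !big_ord_recr/= sqrrD lerD2r; apply: le_trans IH _.
by rewrite lerDl mulrn_wge0// mulr_ge0// sumr_ge0.
Qed.

Lemma gen_fun_ge0 (R : realType) (S : set nat) (t : R) : 0 <= t ->
  (0 <= gen_fun S t)%E.
Proof. by move=> t0; apply: esum_ge0 => s _; rewrite lee_fin exprn_ge0. Qed.

(** The supremum is tested on the first [N] blocks, listed without repetition; each exponent is
    below [5 * p ^ 2] and [t <= 1]. *)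
Lemma gen_fun_block_sidon_ge (R : realType) N (t : R) : 0 <= t <= 1 ->
  ((\sum_(n < N) (block_prime n)%:R * t ^+ (5 * block_prime n ^ 2))%:E
   <= gen_fun block_sidon t)%E.
Proof.
case/andP=> t0 t1.
pose r := [seq erdos_turan (block_prime n) k | n <- index_iota 0 N, k <- index_iota 0 (block_prime n)].
have ur : uniq r.
  apply: allpairs_uniq_dep; first exact: iota_uniq.
    by move=> n _; exact: iota_uniq.
  move=> _ _ /allpairsPdep[n [k [_ + ->]]] /allpairsPdep[m [l [_ + ->]]].
  by rewrite !mem_index_iota/= => kn lm /(erdos_turan_block_inj kn lm)[-> ->].
apply: esum_ge; exists [set` r].
  split; first exact: finite_seq.
  move=> _ /= /allpairsPdep[n [k [_ + ->]]]; rewrite mem_index_iota/= => kn.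
  by exists n, k.
rewrite -fsbig_seq// sumEFin lee_fin big_allpairs_dep big_mkord.
apply: ler_sum => n _.
rewrite big_mkord mulr_natl -[X in _ *+ X]card_ord -sumr_const; apply: ler_sum => k _.
by apply: ler_wiXn2l => //; apply: ltnW; exact: erdos_turan_upper.
Qed.

Theorem theorem3p2 (R : realType) :
  exists S : set nat, sidon S /\
    (\int[@lebesgue_measure R]_(t in `[0%R, 1%R]) (gen_fun S t ^+ 2) = +oo)%E.
Proof.
exists block_sidon; split; first exact: sidon_block_sidon.
(* Each block contributes at least 1/11, so [N > 11 * A] blocks exceed the bound [A]. *)
apply/eqyP => A A0; pose N := Num.bound (A * 11).
pose h n (t : R) := ((block_prime n)%:R ^+ 2 * t ^+ (10 * block_prime n ^ 2))%R.
have mh n : measurable_fun (`[0, 1] : set R) (h n).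
  by apply: measurable_funM => //; exact: measurable_funX.
have h0 n t : `[0, 1]%classic t -> (0 <= (h n t)%:E)%E.
  rewrite /= in_itv/= => /andP[t0 _].
  by rewrite lee_fin mulr_ge0// exprn_ge0.
have inth n : ((11^-1)%:E <= \int[@lebesgue_measure R]_(t in `[0%R, 1%R]) (h n t)%:E)%E.
  under eq_integral do rewrite EFinM.
  rewrite ge0_integralZl_EFin ?exprn_ge0//; last first.
  - by apply/measurable_EFinP; exact: measurable_funX.
  - by move=> t /=; rewrite in_itv/= => /andP[t0 _]; rewrite lee_fin exprn_ge0.
  (* The integral is [p ^ 2 / (10 * p ^ 2 + 1)], at least 1/11 since [p ^ 2 >= 1]. *)
  rewrite integral_exprn -EFinM lee_fin -natrX ler_pdivlMr ?ltr0n//.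
  rewrite mulrC ler_pdivrMr ?ltr0n// -natrM ler_nat.
  by have := block_prime_gt2 n; nia.
apply: (@le_trans _ _
  (\int[@lebesgue_measure R]_(t in `[0%R, 1%R]) \sum_(n <- index_iota 0 N) (h n t)%:E)%E).
  rewrite ge0_integral_sum//; last first.
    by move=> n; apply/measurable_EFinP; exact: mh.
  apply: (@le_trans _ _ (\sum_(n <- index_iota 0 N) (11^-1)%:E)%E); last exact: lee_sum.
  rewrite sumEFin lee_fin big_mkord sumr_const card_ord -[_ *+ N]mulr_natl ler_pdivlMr//.
  by apply/ltW/archi_boundP; rewrite mulr_ge0// ltW.
apply: ge0_le_integral_nomeas => t t01; first by apply: sume_ge0 => n _; exact: h0.
move: t01; rewrite /= in_itv/= => t01; have /andP[t0 t1] := t01.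
have s0 n : 0 <= (block_prime n)%:R * t ^+ (5 * block_prime n ^ 2).
  by rewrite mulr_ge0// exprn_ge0.
apply: (@le_trans _ _
  ((\sum_(n < N) (block_prime n)%:R * t ^+ (5 * block_prime n ^ 2))%:E ^+ 2)%E).
  rewrite sumEFin big_mkord -EFin_expe lee_fin.
  apply: le_trans _ (sum_sqr_le N s0); apply: ler_sum => n _.
  by rewrite /h exprMn -exprM (_ : 5 * _ * 2 = 10 * block_prime n ^ 2)%N//; lia.
rewrite lee_sqr ?gen_fun_ge0// ?lee_fin ?sumr_ge0//.
exact: gen_fun_block_sidon_ge.
Qed.
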